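(* Let $q$ be a prime power, $m$ a positive integer, $h=\lfloor m/2\rfloor$, and let $\delta\in [2, q^{m-h})$ be an integer. Then $$d_B(\mathcal{C}_{(q,m,\delta)})=\begin{cases}\delta, & \text{if } q\nmid \delta,\\ \delta+1, & \text{if } q\mid \delta.\end{cases}$$
   Context: Let $\alpha$ be a primitive element of $\mathbb{F}_{q^m}$, $n=q^m-1$, and for an integer $i$ let $m_i(x)$ be the minimal polynomial of $\alpha^i$ over $\mathbb{F}_q$. For an integer $2\le\delta\le n$, $\mathcal{C}_{(q,m,\delta)}$ is the (narrow-sense primitive BCH) cyclic code of length $n$ over $\mathbb{F}_q$, i.e. the ideal of $\mathbb{F}_q[x]/(x^n-1)$, generated by $\mathrm{lcm}(m_1(x),\ldots,m_{\delta-1}(x))$. Its Bose distance $d_B(\mathcal{C}_{(q,m,\delta)})$ is the largest integer $d$ (with $2\le d\le n$) such that $\mathcal{C}_{(q,m,\delta)}=\mathcal{C}_{(q,m,d)}$. *)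

(* Defs.v *)
From HB Require Import structures.
From mathcomp Require Import all_boot all_order all_algebra all_field.
From mathcomp Require Import qpoly.

Set Implicit Arguments.
Unset Strict Implicit.
Unset Printing Implicit Defensive.

Import GRing.Theory.
Local Open Scope ring_scope.

Section PolyLcm.
Variable F : fieldType.
Implicit Types p q r : {poly F}.

(* Monic unless one of the arguments is 0, in which case it is 0. *)
Definition lcmp p q : {poly F} :=
  let r := p * q %/ gcdp p q in (lead_coef r)^-1 *: r.

Lemma lcmp_eqp p q : lcmp p q %= p * q %/ gcdp p q.
Proof.
rewrite /lcmp; set r := _ %/ _.
have [->|r0] := eqVneq r 0; first by rewrite scaler0 eqpxx.
by apply: eqp_scale; rewrite invr_eq0 lead_coef_eq0.
Qed.

Lemma dvdp_lcmp p q r : (lcmp p q %| r) = (p %| r) && (q %| r).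
Proof.
rewrite (eqp_dvdl _ (lcmp_eqp p q)).
have [->|p0] := eqVneq p 0.
  rewrite mul0r div0p dvd0p.
  by have [->|r0] := eqVneq r 0; rewrite ?dvdp0 ?dvd0p ?(negbTE r0).
have g0 : gcdp p q != 0 by rewrite gcdp_eq0 negb_and p0.
have gpq : gcdp p q %| p * q by rewrite dvdp_mulr // dvdp_gcdl.
rewrite -(dvdp_mul2r _ _ g0) (divpK gpq).
rewrite (eqp_dvdr _ (mulp_gcdr p q r)) dvdp_gcd.
rewrite [r * p]mulrC dvdp_mul2l // andbC.
have [->|q0] := eqVneq q 0; last by rewrite dvdp_mul2r.
by rewrite !mulr0 !dvd0p eqxx; have [->|_] := eqVneq r 0; rewrite ?dvdp0 ?andbF.
Qed.

End PolyLcm.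

Section BCH.
Variables (F : finFieldType) (L : fieldExtType F).
Implicit Types (x alpha : L).

(* [minPoly 1 x] is the minimal polynomial of x over F, but typed in {poly L}. *)
Fact minPolyF_subproof x :
  exists p : {poly F}, map_poly (in_alg L) p == minPoly 1 x.
Proof. by have /polyOver1P[p ->] := minPolyOver 1 x; exists p. Qed.

Definition minPolyF x : {poly F} := xchoose (minPolyF_subproof x).

Lemma map_minPolyF x : map_poly (in_alg L) (minPolyF x) = minPoly 1 x.
Proof. exact/eqP/(xchooseP (minPolyF_subproof x)). Qed.

(* |L| - 1, as |L| = |F| ^ [L : F]. *)
Definition bch_length : nat := (#|F| ^ \dim {:L} - 1)%N.

Definition bch_gen alpha (delta : nat) : {poly F} :=
  \big[@lcmp F/1]_(1 <= i < delta) minPolyF (alpha ^+ i).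

Local Notation quotient := {poly %/ ('X^bch_length - 1 : {poly F})}.

Lemma bch_length_gt0 : (0 < bch_length)%N.
Proof.
by rewrite subn_gt0 -(exp1n (\dim {:L})) ltn_exp2r ?adim_gt0 // finNzRing_gt1.
Qed.

(* {poly %/ p} silently becomes {poly %/ 'X} if p is constant or not monic. *)
Lemma bch_modulusE :
  mk_monic ('X^bch_length - 1 : {poly F}) = 'X^bch_length - 1.
Proof.
by rewrite /mk_monic size_XnsubC ?bch_length_gt0 // monicXnsubC ?bch_length_gt0 //
  ltnS bch_length_gt0.
Qed.

Definition bch_code alpha (delta : nat) : {set quotient} :=
  [set a * in_qpoly _ (bch_gen alpha delta) | a : quotient].

Definition bose_distance alpha (C : {set quotient}) : nat :=
  \max_(2 <= d < bch_length.+1 | C == bch_code alpha d) d.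

End BCH.

(* Main.v *)
(* A root of the minimal polynomial of x over F_q is one of the conjugates
   x^(q^j), so the zeros of the code are the alpha^e with e congruent to some
   i * q^j, 0 < i < delta, modulo n = q^m - 1.  When q does not divide
   delta < q^(m - h), delta is the least element of its q-cyclotomic coset:
   either i * q^j (if j <= h) or delta * q^(m - j) (if j > h) is below q^m, and
   the congruence becomes an equality.  Hence alpha^delta is a zero of every
   code of larger designed distance, but not of this one.  When q divides
   delta, alpha^delta is a conjugate of alpha^(delta / q), and delta + 1 gives
   the same code. *)
Require Import Defs.
From mathcomp Require Import all_boot all_order all_algebra all_field.
From mathcomp Require Import all_fingroup qpoly zify.

Set Implicit Arguments.
Unset Strict Implicit.
Unset Printing Implicit Defensive.

Import GRing.Theory.
Local Open Scope ring_scope.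

(** The residues are represented by 1, ..., n, with n in place of 0, since the exponents compared
    later are positive and bounded by n itself. *)
Lemma eqn_mod_pos (n a b : nat) :
  (0 < a <= n)%N -> (0 < b <= n)%N -> a = b %[mod n] -> a = b.
Proof.
move=> /andP[a0 an] /andP[b0 bn].
wlog ab : a b a0 an b0 bn / (a <= b)%N.
  by move=> W; case: (leqP a b) => [|/ltnW] ab E; [|symmetry]; apply: W.
move/esym/eqP; rewrite eqn_mod_dvd // => dv.
have [/eqP|ba0] := posnP (b - a); first by lia.
by have := dvdn_leq ba0 dv; lia.
Qed.

Lemma coset_leader (q m d i j : nat) :
  (1 < q)%N -> (d < q ^ (m - m./2))%N -> ~~ (q %| d)%N ->
  (0 < i < d)%N -> (j < m)%N -> d <> i * q ^ j %[mod q ^ m - 1].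
Proof.
move=> q1 dlt qd /andP[i0 id] jm E.
have q0 : (0 < q)%N by lia.
have qp k : (0 < q ^ k)%N by rewrite expn_gt0 q0.
have hm : (m./2 + m./2 <= m <= (m./2 + m./2).+1)%N by lia.
have dm : (d < q ^ m)%N.
  by apply: leq_trans dlt _; rewrite leq_exp2l // leq_subr.
(* Stated for all [a <= d] so as to serve both [i * q ^ j] and [d * q ^ (m - j)]. *)
have small a k : (0 < a <= d)%N -> (k <= m./2)%N ->
    (0 < a * q ^ k <= q ^ m - 1)%N.
  move=> /andP[a0 ad] kh; rewrite muln_gt0 a0 qp /=.
  suff : (a * q ^ k < q ^ m)%N by lia.
  have -> : m = (m - m./2 + m./2)%N by lia.
  rewrite expnD -(ltn_pmul2r (qp k)) in dlt *.
  apply: leq_ltn_trans (_ : d * q ^ k < _)%N; first by rewrite leq_mul2r ad orbT.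
  by apply: leq_trans dlt _; rewrite leq_mul2l leq_exp2l // kh orbT.
have [jh|hj] := leqP j m./2.
  have : d = (i * q ^ j)%N by apply: eqn_mod_pos E; [lia | apply: small; lia].
  case: j {jm E jh} => [|j] dE; first by lia.
  by move: qd; rewrite dE expnS mulnCA dvdn_mulr.
(* Multiplying the congruence by [q ^ (m - j)] leaves [i] on the right, because [q ^ m] is 1 modulo
   [q ^ m - 1]; but [i < d] rules out the equality. *)
have : (d * q ^ (m - j))%N = i.
  apply: (@eqn_mod_pos (q ^ m - 1)); [by apply: small; lia | by lia |].
  rewrite -modnMml E modnMml -mulnA -expnD subnKC; last exact: ltnW.
  by rewrite -{1}(subnK (qp m)) mulnDr muln1 modnMDl.
by have := leq_pmulr d (qp (m - j)%N); lia.
Qed.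

Section Conjugates.
Variable F : finFieldType.

(** The extension is Galois with cyclic group generated by the Frobenius map, so the roots are the
    orbit of [x] under the powers of that map. *)
Lemma root_minPoly_conj (L : fieldExtType F) (x y : L) :
  root (minPoly 1 x) y <->
  exists2 j, (j < \dim {:L})%N & y = x ^+ (#|F| ^ j).
Proof.
(* The Galois theory used below needs a splitting field structure, which every finite extension of a
   finite field carries. *)
move: x y; wlog [{}L -> x y]: L / exists galL : splittingFieldType F, L = galL.
  by pose galL := FinSplittingFieldType F L => /(_ galL); apply; exists galL.
have [s /eqP sgen sE] := finField_galois_generator (sub1v (fullv : {vspace L})).
have sXE j : (s ^+ j)%g x = x ^+ (#|F| ^ j).
  elim: j => [|j IHj]; first by rewrite gal_id.
  by rewrite expgSr galM ?memvf // IHj sE ?memvf // dimv1 expn1 expnSr exprM.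
have galL : galois 1 {:L} by apply: finField_galois; rewrite sub1v.
have os : #[s]%g = \dim {:L}.
  by rewrite orderE -sgen -galois_dim // dimv1 divn1.
split=> [|[j _ ->]]; last first.
  rewrite -sXE root_minPoly_gal ?memvf ?sub1v //.
  by apply/groupX/(subsetP _ s (cycle_id s)); rewrite -sgen.
have /and3P[_ _ nL] := galL.
have [r rG ->] := normalField_factors (sub1v _) nL x (memvf x).
rewrite -(big_map (fun g : gal_of _ => g x) xpredT (fun z => 'X - z%:P)).
rewrite root_prod_XsubC => /mapP[g gr ->].
have := subsetP rG g gr; rewrite sgen => /cyclePmin[j js ->].
by exists j; rewrite ?sXE -?os.
Qed.

Lemma root_minPoly_card (L : fieldExtType F) (x : L) :
  root (minPoly 1 x) (x ^+ #|F|).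
Proof.
apply/root_minPoly_conj; have [d1|d1] := ltnP 1 (\dim {:L}).
  by exists 1%N; rewrite ?expn1.
have d1E : \dim {:L} = 1%N by apply/eqP; rewrite eqn_leq d1 adim_gt0.
(* In degree 1 the only exponent allowed is 0, and Fermat's little theorem gives [x ^+ #|F| = x]. *)
exists 0%N; first by rewrite d1E.
by apply/eqP; rewrite expn0 expr1 -[#|F|]expn1 -d1E -Fermat's_little_theorem memvf.
Qed.

End Conjugates.

Section BCH.
Variables (F : finFieldType) (L : fieldExtType F).
Implicit Types (x y alpha : L) (p : {poly F}).
Local Notation n := (bch_length L).
Local Notation "p ^L" := (map_poly (in_alg L) p) (at level 2, format "p ^L").

Lemma bch_gen_dvdP alpha (d : nat) p :
  reflect (forall i, (1 <= i < d)%N -> minPolyF (alpha ^+ i) %| p)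
          (bch_gen alpha d %| p).
Proof.
rewrite /bch_gen; apply: (iffP idP) => [|H].
  move=> + i /andP[i1 id].
  have : i \in index_iota 1 d by rewrite mem_index_iota i1.
  elim: (index_iota 1 d) => // k s IHs.
  rewrite inE big_cons dvdp_lcmp => /orP[/eqP->|/IHs-IH] /andP[] //.
have : {subset index_iota 1 d <= index_iota 1 d} by [].
elim: {1 3}(index_iota 1 d) => [|k s IHs] sub; first by rewrite big_nil dvd1p.
rewrite big_cons dvdp_lcmp IHs ?andbT => [|i si]; last by rewrite sub // inE si orbT.
by apply: H; rewrite -mem_index_iota sub ?inE ?eqxx.
Qed.

Lemma root_bch_gen alpha (d : nat) y :
  reflect (exists2 i, (1 <= i < d)%N & root (minPoly 1 (alpha ^+ i)) y)
          (root (bch_gen alpha d)^L y).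
Proof.
apply: (iffP idP) => [ry|[i id ry]]; last first.
  have /(_ i id) := bch_gen_dvdP alpha d (bch_gen alpha d) (dvdpp _).
  rewrite -(dvdp_map (in_alg L)) map_minPolyF => /dvdpP[c ->].
  by rewrite rootM ry orbT.
(* The lcm divides the product, and a root of a product is a root of some factor. *)
pose P := \prod_(i <- index_iota 1 d) minPolyF (alpha ^+ i).
have : bch_gen alpha d %| P.
  apply/bch_gen_dvdP => i id.
  rewrite /P (bigD1_seq i) ?iota_uniq ?mem_index_iota //= dvdp_mulr //.
rewrite -(dvdp_map (in_alg L)) => /dvdpP[c PE].
have : root P^L y by rewrite PE rootM ry orbT.
rewrite /P rmorph_prod => /eqP/=; rewrite horner_prod => /eqP.
rewrite prodf_seq_eq0 => /hasP[i]; rewrite mem_index_iota map_minPolyF => id ri.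
by exists i.
Qed.

Lemma in_qpoly_bch_gen alpha (d : nat) :
  in_qpoly ('X^n - 1) (bch_gen alpha d) \in bch_code alpha d.
Proof. by apply/imsetP; exists 1; rewrite ?mul1r. Qed.

(** Reduction changes [p] by a multiple of ['X^n - 1], which vanishes at [y]; thus zeros among the
    n-th roots of unity make sense in the quotient. *)
Lemma root_in_qpoly p y :
  y ^+ n = 1 -> root (in_qpoly ('X^n - 1) p : {poly F})^L y = root p^L y.
Proof.
move=> yn; have M := monic_mk_monic ('X^n - 1 : {poly F}).
rewrite /= {2}(Pdiv.RingMonic.rdivp_eq M p) [in RHS]rmorphD rmorphM /=.
rewrite !rootE hornerD hornerM bch_modulusE rmorphB /= map_polyXn rmorph1.
by rewrite !hornerE yn subrr mulr0 add0r.
Qed.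

Lemma root_bch_code alpha (d : nat) y (c : {poly %/ ('X^n - 1 : {poly F})}) :
  y ^+ n = 1 -> root (bch_gen alpha d)^L y -> c \in bch_code alpha d ->
  root (c : {poly F})^L y.
Proof.
move=> yn ry /imsetP[a _ ->].
have -> : a = in_qpoly ('X^n - 1) (a : {poly F}).
  by apply: val_inj; rewrite [RHS]in_qpoly_small // size_mk_monic.
by rewrite -in_qpolyM root_in_qpoly // rmorphM rootM ry orbT.
Qed.

Lemma eq_bch_code_eqp alpha (d d' : nat) :
  bch_gen alpha d %= bch_gen alpha d' -> bch_code alpha d = bch_code alpha d'.
Proof.
have sub e e' : bch_gen alpha e' %| bch_gen alpha e ->
    bch_code alpha e \subset bch_code alpha e'.
  move=> /dvdpP[c E]; apply/subsetP => _ /imsetP[a _ ->]; rewrite E in_qpolyM.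
  by apply/imsetP; exists (a * in_qpoly ('X^n - 1) c); rewrite // mulrA.
by case/andP => dd' d'd; apply/eqP; rewrite eqEsubset !sub.
Qed.

Lemma bch_code_dvd_succ alpha (d : nat) :
  (0 < d)%N -> (#|F| %| d)%N -> bch_code alpha d = bch_code alpha d.+1.
Proof.
move=> d0 /dvdnP[k dE]; apply: eq_bch_code_eqp; apply/andP; split.
  apply/bch_gen_dvdP => i /andP[i1 id].
  by apply: (bch_gen_dvdP _ _ _ (dvdpp _)); rewrite i1 ltnS ltnW.
have F1 := finNzRing_gt1 F.
apply/bch_gen_dvdP => i /andP[i1]; rewrite ltnS leq_eqVlt.
case/predU1P => [->|id]; last by apply: (bch_gen_dvdP _ _ _ (dvdpp _)); rewrite i1.
(* With [k = d / #|F|] already in range, the only new factor, that of [alpha ^+ d], divides the one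
   of [alpha ^+ k]. *)
have kd : (1 <= k < d)%N.
  move: d0; rewrite dE muln_gt0 => /andP[k0 _].
  by rewrite k0 ltn_Pmulr.
apply: dvdp_trans (bch_gen_dvdP alpha d _ (dvdpp _) k kd).
rewrite -(dvdp_map (in_alg L)) !map_minPolyF minPoly_dvdp ?minPolyOver //.
by rewrite dE exprM root_minPoly_card.
Qed.

End BCH.

Lemma bose_distance_ndvd (F : finFieldType) (L : fieldExtType F)
    (alpha : L) (d : nat) :
  let m := \dim {:L} in
  (bch_length L).-primitive_root alpha ->
  (2 <= d < #|F| ^ (m - m./2))%N -> ~~ (#|F| %| d)%N ->
  bose_distance alpha (bch_code alpha d) = d.
Proof.
move=> m prim /andP[d2 dlt] qd; have q1 := finNzRing_gt1 F.
have dn : (d <= bch_length L)%N.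
  have : (d < #|F| ^ m)%N by apply: leq_trans dlt _; rewrite leq_exp2l // leq_subr.
  by rewrite /bch_length -/m; lia.
apply/eqP; rewrite eqn_leq; apply/andP; split; last first.
  by apply: (leq_bigmax_seq d); rewrite // mem_index_iota d2 ltnS.
apply/bigmax_leqP_seq => e; rewrite mem_index_iota => _ /eqP Ce.
rewrite leqNgt; apply/negP => de.
have an k : (alpha ^+ k) ^+ bch_length L = 1.
  by rewrite exprAC (prim_expr_order prim) expr1n.
(* The generator for [d] is a codeword of the code for [e], and all those codewords vanish at
   [alpha ^+ d] because [d < e]. *)
have : root (map_poly (in_alg L) (bch_gen alpha d)) (alpha ^+ d).
  rewrite -root_in_qpoly //; apply: (@root_bch_code _ _ alpha e) => //.
    by apply/root_bch_gen; exists d; rewrite ?root_minPoly // (ltnW d2).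
  by rewrite -Ce in_qpoly_bch_gen.
case/root_bch_gen => i id /root_minPoly_conj[j jm] /eqP.
rewrite -exprM (eq_prim_root_expr prim) => /eqP.
exact: coset_leader.
Qed.

Theorem theorem5 (q m h : nat) (F : finFieldType) (L : fieldExtType F)
    (alpha : L) (delta : nat)
    (hq : #|F| = q) (hm0 : (0 < m)%N) (hm : \dim {:L} = m) (hh : h = m./2)
    (halpha : ((q ^ m - 1)%N.-primitive_root alpha)%R)
    (hdelta : (2 <= delta < q ^ (m - h))%N) :
  bose_distance alpha (bch_code alpha delta)
  = if ~~ (q %| delta)%N then delta else delta.+1.
Proof.
subst q m h; case: ifPn => [|/negPn] qd; first exact: bose_distance_ndvd.
have q1 := finNzRing_gt1 F; have /andP[d2 dlt] := hdelta.
have qdS : ~~ (#|F| %| delta.+1)%N.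
  by rewrite -addn1 dvdn_addr // dvdn1 eqn_leq negb_and -ltnNge q1.
rewrite bch_code_dvd_succ //; last exact: ltnW.
apply: bose_distance_ndvd => //; rewrite ltnW //= ltn_neqAle dlt andbT.
(* The bound must still hold for [delta.+1]: were it equal to [#|F| ^ (m - m./2)], whose exponent is
   positive, [#|F|] would divide it. *)
apply: contraNneq qdS => ->.
rewrite -[X in (X %| _)%N]expn1 dvdn_exp2l //.
lia.
Qed.
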